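(* Let $T\ge 2$ be an integer and let $\mu>0$, $\sigma>0$, $-\frac{1}{T-1}<\rho<1$ satisfy $\mu^2+\rho\sigma^2>0$. Let $\mathcal P$ be the ambiguity set defined in the context. For any permutation-symmetric continuous functional $h:\mathbb R^T_+\to\mathbb R$, the quantity $$\sup_{\mathbb P\in\mathcal P}\mathbb P\left(h(\tilde{\boldsymbol\xi})\le 0\right)$$ is equal to the optimal value of the semi-infinite program $$ \begin{aligned} \inf\ \ & \alpha+T\mu\beta+T(\mu^2+\sigma^2)\gamma_1+T\left[T\mu^2+\sigma^2+(T-1)\rho\sigma^2\right]\gamma_2\\ \text{s.t.}\ \ & \alpha,\lambda_1,\lambda_2\in\mathbb R_+,\ \beta,\gamma_1,\gamma_2\in\mathbb R\\ & \gamma_1+\gamma_2\ge 0,\quad \gamma_2+\gamma_1+\alpha\ge\left\Vert\left(\beta-\lambda_1,\ \gamma_2+\gamma_1-\alpha\right)\right\Vert_2\\ & \tfrac{\gamma_1}{T}+\gamma_2\ge 0,\quad \gamma_2+\tfrac{\gamma_1}{T}+\alpha\ge\left\Vert\left(\beta-\lambda_2,\ \gamma_2+\tfrac{\gamma_1}{T}-\alpha\right)\right\Vert_2\\ & \alpha+\beta s+\gamma_2s^2+\gamma_1\underline\phi(s)\ge 1\quad\forall s\in\mathcal S\\ & \alpha+\beta s+\gamma_2s^2+\gamma_1\overline\phi(s)\ge 1\quad\forall s\in\mathcal S, \end{aligned} $$ where, for all $s\ge 0$, $$\underline\phi(s)=\inf_{\boldsymbol\xi\ge\boldsymbol 0}\left\{\Vert\boldsymbol\xi\Vert_2^2:\Vert\boldsymbol\xi\Vert_1=s,\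 h(\boldsymbol\xi)\le 0\right\},\qquad \overline\phi(s)=\sup_{\boldsymbol\xi\ge\boldsymbol 0}\left\{\Vert\boldsymbol\xi\Vert_2^2:\Vert\boldsymbol\xi\Vert_1=s,\ h(\boldsymbol\xi)\le 0\right\},$$ and $\mathcal S=\{s\in\mathbb R_+:\underline\phi(s)<+\infty\}$.
   Context: Conventions: $\inf\emptyset=+\infty$, $\sup\emptyset=-\infty$. ''Permutation-symmetric'' means that $h(\boldsymbol\xi)$ is unchanged when the components of $\boldsymbol\xi$ are permuted. Let $\boldsymbol\mu=\mu\boldsymbol 1\in\mathbb R^T$ and $\boldsymbol\Sigma=(1-\rho)\sigma^2\mathbb I+\rho\sigma^2\boldsymbol 1\boldsymbol 1^\intercal$, where $\mathbb I$ is the $T\times T$ identity matrix and $\boldsymbol 1$ the all-ones vector. $\mathcal P$ is the set of all Borel probability distributions $\mathbb P$ of a random vector $\tilde{\boldsymbol\xi}=(\tilde\xi_1,\dots,\tilde\xi_T)^\intercal$ supported on $\mathbb R^T_+$ with $\mathbb E_{\mathbb P}(\tilde{\boldsymbol\xi})=\boldsymbol\mu$ and $\mathbb E_{\mathbb P}(\tilde{\boldsymbol\xi}\tilde{\boldsymbol\xi}^\intercal)=\boldsymbol\Sigma+\boldsymbol\mu\boldsymbol\mu^\intercal$. *)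

(* Defs.v *)
From HB Require Import structures.
From mathcomp Require Import all_boot all_order all_algebra all_fingroup.
From mathcomp Require Import all_classical all_reals all_analysis.

Set Implicit Arguments.
Unset Strict Implicit.
Unset Printing Implicit Defensive.

Import Order.TTheory GRing.Theory Num.Theory.
Import numFieldNormedType.Exports.

Local Open Scope classical_set_scope.
Local Open Scope ring_scope.

(* R^T (column vectors) with its Borel sigma-algebra; convertible to 'cV[R]_T. *)
Definition borel_cV (R : realType) (T : nat) :=
  g_sigma_algebraType (@open 'cV[R]_T).

(* The norm `|x| that the library puts on matrices is the sup norm, hence the
   explicit l1 and l2 norms. *)
Definition l1norm (R : realType) (T : nat) (x : 'cV[R]_T) : R :=
  \sum_(i < T) `|x i 0|.

Definition l2norm (R : realType) (T : nat) (x : 'cV[R]_T) : R :=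
  Num.sqrt (\sum_(i < T) x i 0 ^+ 2).

Definition vec2 (R : realType) (a b : R) : 'cV[R]_2 :=
  \col_(i < 2) [:: a; b]`_i.

Definition orthant (R : realType) (T : nat) : set 'cV[R]_T :=
  [set x | forall i, 0 <= x i 0].

Definition ones (R : realType) (T : nat) : 'cV[R]_T := const_mx 1.

Definition mean_vec (R : realType) (T : nat) (mu : R) : 'cV[R]_T :=
  mu *: ones R T.

Definition cov_mx (R : realType) (T : nat) (sigma rho : R) : 'M[R]_T :=
  ((1 - rho) * sigma ^+ 2) *: 1%:M
  + (rho * sigma ^+ 2) *: (ones R T *m (ones R T)^T).

(* Since integrals are \bar R-valued and +oo - oo = -oo in the library, a moment
   equal to a real number is in particular an absolutely convergent integral. *)
Definition ambiguity_set (R : realType) (T : nat) (mu sigma rho : R) :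
    set (probability (borel_cV R T) R) :=
  [set P : probability (borel_cV R T) R | [/\ P (@orthant R T) = 1%E,
    (forall i : 'I_T,
       expectation P (fun x : 'cV[R]_T => x i 0)
       = (mean_vec T mu i 0)%:E) &
    (forall i j : 'I_T,
       expectation P (fun x : 'cV[R]_T => (x *m x^T) i j)
       = ((cov_mx T sigma rho + mean_vec T mu *m (mean_vec T mu)^T) i j)%:E)]].

(* Functionals on the nonnegative orthant are represented by functions on all of
   R^T; their values outside of the orthant are never used. *)
Definition perm_symmetric (R : realType) (T : nat) (h : 'cV[R]_T -> R) : Prop :=
  forall (s : 'S_T) (x : 'cV[R]_T), orthant x -> h (row_perm s x) = h x.

Definition worst_case_prob (R : realType) (T : nat) (mu sigma rho : R)
    (h : 'cV[R]_T -> R) : \bar R :=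
  ereal_sup [set P [set x : 'cV[R]_T | orthant x /\ h x <= 0]
            | P in @ambiguity_set R T mu sigma rho].

Definition phi_values (R : realType) (T : nat) (h : 'cV[R]_T -> R) (s : R) :
    set (\bar R) :=
  [set (l2norm x ^+ 2)%:E
  | x in [set x : 'cV[R]_T | [/\ orthant x, l1norm x = s & h x <= 0]]].

Definition phi_lo (R : realType) (T : nat) (h : 'cV[R]_T -> R) (s : R) : \bar R :=
  ereal_inf (phi_values h s).

Definition phi_up (R : realType) (T : nat) (h : 'cV[R]_T -> R) (s : R) : \bar R :=
  ereal_sup (phi_values h s).

Definition S_set (R : realType) (T : nat) (h : 'cV[R]_T -> R) : set R :=
  [set s | 0 <= s /\ (phi_lo h s < +oo)%E].

Definition sip_objective (R : realType) (T : nat) (mu sigma rho : R)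
    (alpha beta gamma1 gamma2 : R) : R :=
  alpha + T%:R * mu * beta + T%:R * (mu ^+ 2 + sigma ^+ 2) * gamma1
  + T%:R * (T%:R * mu ^+ 2 + sigma ^+ 2 + (T%:R - 1) * rho * sigma ^+ 2)
    * gamma2.

(* phi_lo and phi_up are finite on S_set, so no indeterminate form arises in the
   extended-real constraints. *)
Definition sip_feasible (R : realType) (T : nat) (h : 'cV[R]_T -> R)
    (alpha lambda1 lambda2 beta gamma1 gamma2 : R) : Prop :=
  [/\ [/\ 0 <= alpha, 0 <= lambda1 & 0 <= lambda2],
      0 <= gamma1 + gamma2 /\
      l2norm (vec2 (beta - lambda1) (gamma2 + gamma1 - alpha))
        <= gamma2 + gamma1 + alpha,
      0 <= gamma1 / T%:R + gamma2 /\
      l2norm (vec2 (beta - lambda2) (gamma2 + gamma1 / T%:R - alpha))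
        <= gamma2 + gamma1 / T%:R + alpha,
      (forall s : R, S_set h s ->
        (1 <= (alpha + beta * s + gamma2 * s ^+ 2)%:E
              + gamma1%:E * phi_lo h s)%E) &
      (forall s : R, S_set h s ->
        (1 <= (alpha + beta * s + gamma2 * s ^+ 2)%:E
              + gamma1%:E * phi_up h s)%E)].

Definition sip_value (R : realType) (T : nat) (mu sigma rho : R)
    (h : 'cV[R]_T -> R) : \bar R :=
  ereal_inf [set v | exists alpha lambda1 lambda2 beta gamma1 gamma2 : R,
    sip_feasible h alpha lambda1 lambda2 beta gamma1 gamma2 /\
    v = (sip_objective T mu sigma rho alpha beta gamma1 gamma2)%:E].

(* Main.v *)
(* Both sides only involve the scalar statistics s = sum x_i and
   q = sum x_i^2.  A dual feasible point is a function
   alpha + beta s + gamma2 s^2 + gamma1 q that dominates the indicator of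
   {h <= 0} on the orthant: since it is affine in q, it suffices to test the
   extreme values of q for given s, namely s^2/T and s^2 for nonnegativity
   (a quadratic in s >= 0, whence the second-order cone constraints) and the
   two phi's where h <= 0.  Integrating such a majorant gives weak duality.
   Conversely, the assumptions on mu, sigma and rho say that the prescribed
   moments of (1, s, s^2, q) lie in the interior of the moment cone, so the
   largest mass of {h <= 0} attainable by finitely supported measures has a
   supergradient there, which is an optimal dual solution; symmetrizing these
   measures over the coordinate permutations puts them in the ambiguity set. *)
Require Import Defs.
From HB Require Import structures.
From mathcomp Require Import all_boot all_order all_algebra all_fingroup.
From mathcomp Require Import all_classical all_reals all_analysis.
From mathcomp Require Import measurable_realfun ring lra.
Import Order.TTheory GRing.Theory Num.Theory.
Import numFieldNormedType.Exports.
Local Open Scope classical_set_scope.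
Local Open Scope ring_scope.

(** * Extending a linear majorant of the values of a convex cone *)

Section cone_extension.
Context {R : realType} {V : lmodType R}.
Variables (C : V -> R -> Prop) (M : V) (x : nat -> V).
Hypothesis CD : forall v w t u, C v t -> C w u -> C (v + w) (t + u).
Hypothesis CZ : forall (k : R) v t, 0 <= k -> C v t -> C (k *: v) (k * t).
Hypothesis M_sup : has_sup [set t | C M t].

Let p := sup [set t | C M t].

(** This is the bound on the line through [M]. Positive multiples follow by scaling. A positive
    value over [0] could be added repeatedly to one over [M], contradicting the finite supremum.
    Negative multiples reduce to [0] by adding a positive multiple. *)
Lemma cone_le_sup a t : C (a *: M) t -> t <= a * p.
Proof.
have leM u : C M u -> u <= p by move=> Cu; apply: sup_upper_bound.
have pos b u : 0 < b -> C (b *: M) u -> u <= b * p.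
  move=> b0 /(CZ _ _ _ (ltW (eqbRL (invr_gt0 b) b0))).
  by rewrite scalerA mulVf ?gt_eqF// scale1r => /leM; rewrite ler_pdivrMl.
have [[t0 Ct0] _] := M_sup.
have zero u : C 0 u -> u <= 0.
  move=> Cu; rewrite leNgt; apply/negP => u0.
  (* This multiple of [u] raises [t0] to [t0 + |p - t0| + 1], which exceeds [p]. *)
  have k0 : 0 <= (`|p - t0| + 1) / u by rewrite divr_ge0 ?ltW// addr_ge0.
  have := CD _ _ _ _ Ct0 (CZ _ _ _ k0 Cu).
  rewrite scaler0 addr0 divfK ?gt_eqF// => /leM.
  by have := ler_norm (p - t0); lra.
have [a0|a0|->] := ltgtP a 0; last 2 first.
- exact: pos.
- by rewrite scale0r mul0r; exact: zero.
move=> Ct; rewrite leNgt; apply/negP => lt_t.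
(* As [a < 0], the assumption [a * p < t] means [t / a < p]; a value [u] over [M] above [t / a]
   yields [t - a * u > 0] over [0]. *)
have [|u Cu lt_u] := sup_adherent (eps := p - t / a) _ M_sup.
  by rewrite subr_gt0 ltr_ndivrMr// mulrC.
have a1 : 0 <= - a by lra.
have := CD _ _ _ _ Ct (CZ _ _ _ a1 Cu).
rewrite -scalerDl subrr scale0r => /zero.
by move: lt_u; rewrite opprB addrC subrK ltr_ndivrMr// -/p; lra.
Qed.

Hypothesis M_intp : forall i, exists k t, C (k *: M + x i) t.
Hypothesis M_intn : forall i, exists k t, C (k *: M - x i) t.

(* One-dimension-at-a-time extension, as in M. Riesz's theorem: the admissible
   slopes in the new direction form a nonempty bounded interval because [M] is
   interior to the domain. *)
Lemma cone_extension n : exists y : nat -> R, forall a (c : nat -> R) t,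
  C (a *: M + \sum_(i < n) c i *: x i) t -> t <= a * p + \sum_(i < n) c i * y i.
Proof.
elim: n => [|n [y IH]].
  by exists (fun=> 0) => a c t; rewrite !big_ord0 !addr0; exact: cone_le_sup.
(* [D] collects the lower bounds on the new slope, from elements with coefficient [1] on [x n].
   Coefficient [-1] gives upper bounds; in [Dub] the two contributions of [x n] cancel, so [IH]
   compares them. *)
pose D : set R := [set r | exists a (c : nat -> R) t,
  C (a *: M + \sum_(i < n) c i *: x i + x n) t /\
  r = t - (a * p + \sum_(i < n) c i * y i)].
have Dub a (c : nat -> R) t : C (a *: M + \sum_(i < n) c i *: x i - x n) t ->
    ubound D (a * p + \sum_(i < n) c i * y i - t).
  move=> Ct r [a' [c' [t' [Ct' ->]]]].
  have := CD _ _ _ _ Ct Ct'; rewrite addrACA addNr addr0 addrACA -scalerDl.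
  rewrite -big_split/=.
  under eq_bigr do rewrite -scalerDl.
  move=> /(IH _ (fun i => c i + c' i)) /=.
  under eq_bigr do rewrite mulrDl.
  by rewrite big_split/=; lra.
have Dsup : has_sup D.
  split.
    have [k [t Ct]] := M_intp n; exists (t - (k * p + \sum_(i < n) 0 * y i)).
    exists k, (fun=> 0), t; split => //.
    by under eq_bigr do rewrite scale0r; rewrite big1// addr0.
  have [k [t Ct]] := M_intn n.
  exists (k * p + \sum_(i < n) 0 * y i - t); apply: (Dub k (fun=> 0)).
  by under eq_bigr do rewrite scale0r; rewrite big1// addr0.
pose y' i := if i == n then sup D else y i.
have y'E (c : nat -> R) : \sum_(i < n.+1) c i * y' i = \sum_(i < n) c i * y i + c n * sup D.
  rewrite big_ord_recr/= /y' eqxx; congr (_ + _); apply: eq_bigr => i _.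
  by rewrite ltn_eqF.
exists y' => a c t; rewrite y'E big_ord_recr/= => Ct.
(* Dividing by [c n] or [- c n] normalizes the last coefficient to [1] or [-1], the cases covered by
   [D] and [Dub]. *)
have scale k : 0 < k -> C (a / k *: M + \sum_(i < n) (c i / k) *: x i + (c n / k) *: x n) (t / k).
  move=> k0; have k1 : 0 <= k^-1 by rewrite invr_ge0 ltW.
  have := CZ _ _ _ k1 Ct; rewrite !scalerDr !scaler_sumr addrA scalerA (mulrC t).
  under eq_bigr do rewrite scalerA mulrC.
  by rewrite scalerA ![k^-1 * _]mulrC.
have sumE k : \sum_(i < n) c i / k * y i = (\sum_(i < n) c i * y i) / k.
  by rewrite mulr_suml; apply: eq_bigr => i _; rewrite mulrAC.
have [c0|c0|c0] := ltgtP (c n) 0; last first.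
- move: Ct; rewrite c0 scale0r mul0r !addr0; exact: IH.
- have := scale _ c0; rewrite divff ?gt_eqF// scale1r => Cs.
  have : D (t / c n - (a / c n * p + \sum_(i < n) c i / c n * y i)).
    by exists (a / c n), (fun i => c i / c n), (t / c n).
  move=> /(sup_upper_bound Dsup); rewrite sumE.
  rewrite -(ler_pM2l c0) mulrBr mulrDr [_ * (a / _ * _)]mulrA.
  by rewrite ![c n * (_ / _)]mulrC !divfK ?gt_eqF//; lra.
- have nc0 : 0 < - c n by lra.
  have := scale _ nc0; rewrite (_ : c n / - c n = -1); last by field; lra.
  rewrite scaleN1r => Cs.
  have /(ge_sup Dsup.1) := Dub (a / - c n) (fun i => c i / - c n) _ Cs.
  rewrite sumE -(ler_pM2l nc0) mulrBr mulrDr [_ * (a / _ * _)]mulrA.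
  by rewrite ![- c n * (_ / _)]mulrC !divfK ?gt_eqF//; lra.
Qed.

End cone_extension.

(** * Nonnegativity of quadratics on the half-line *)

Section quadratic.
Context {R : realType}.
Implicit Types a b c l g : R.

(** Squaring both sides leaves [(g + a) ^+ 2 - (g - a) ^+ 2 = 4 * a * g]: the cone constraint is a
    discriminant condition. *)
Lemma soc_constraintE a b g : 0 <= a -> 0 <= g ->
  (l2norm (vec2 b (g - a)) <= g + a) = (b ^+ 2 <= 4 * a * g).
Proof.
move=> a0 g0; rewrite /l2norm !big_ord_recl big_ord0 !mxE/= addr0.
rewrite -[X in _ <= X]ger0_norm ?addr_ge0// -sqrtr_sqr ler_sqrt ?sqr_ge0//.
by apply/idP/idP; lra.
Qed.

Lemma quadratic_ge0 a b c l s : 0 <= a -> 0 <= c -> 0 <= l ->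
  (b - l) ^+ 2 <= 4 * a * c -> 0 <= s -> 0 <= a + b * s + c * s ^+ 2.
Proof.
move=> a0 c0 l0 disc s0.
suff : 0 <= a + (b - l) * s + c * s ^+ 2 by have := mulr_ge0 l0 s0; lra.
move: disc; have [->|cN0] := eqVneq c 0.
  rewrite mulr0 => disc; have /eqP : (b - l) ^+ 2 = 0.
    by apply/eqP; rewrite eq_le disc sqr_ge0.
  by rewrite sqrf_eq0 => /eqP ->; rewrite !mul0r !addr0.
have c1 : 0 < c by rewrite lt0r cN0.
by have := sqr_ge0 (2 * c * s + (b - l)) => sq disc; nra.
Qed.

(** Converse of [quadratic_ge0]. If [b >= 0], then [l = b] cancels the linear term. If [b < 0], the
    minimizer [- b / (2 * c)] lies in the half-line, so the discriminant is already nonpositive and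
    [l = 0] works. *)
Lemma quadratic_multiplier a b c :
  (forall s, 0 <= s -> 0 <= a + b * s + c * s ^+ 2) ->
  0 <= c /\ exists2 l, 0 <= l & (b - l) ^+ 2 <= 4 * a * c.
Proof.
move=> q0.
have a0 : 0 <= a by have := q0 0 (lexx 0); rewrite mulr0 expr0n mulr0 !addr0.
have c0 : 0 <= c.
  rewrite leNgt; apply/negP => c0.
  (* Here [- c * s] exceeds [a + |b|]; with [s >= 1] this makes the quadratic negative at [s]. *)
  pose s := 1 + (a + `|b|) / - c.
  have s1 : 1 <= s by rewrite lerDl divr_ge0 ?addr_ge0//; lra.
  have : - c * (s - 1) = a + `|b| by rewrite /s; field; lra.
  have := q0 s (le_trans ler01 s1); have := ler_norm b; have := normr_ge0 b.
  by nra.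
split => //; have [b0|b0] := leP 0 b.
  by exists b => //; rewrite subrr expr0n/= !mulr_ge0.
exists 0 => //; rewrite subr0.
have cN0 : c != 0.
  (* At this point the affine function [a + b * s] equals [-1]. *)
  apply/eqP => cE; have s0 : 0 <= (a + 1) / - b by rewrite divr_ge0; lra.
  have := q0 _ s0.
  rewrite cE mul0r addr0 (_ : b * _ = - (a + 1)); first by lra.
  by field; lra.
have c1 : 0 < c by rewrite lt0r cN0.
have s0 : 0 <= - b / (2 * c) by rewrite divr_ge0; lra.
have := q0 _ s0.
rewrite (_ : _ + _ = a - b ^+ 2 / (4 * c)); last by field.
by rewrite subr_ge0 ler_pdivrMr ?mulr_gt0//; lra.
Qed.

End quadratic.

(** * The sum and the sum of squares of the coordinates *)

Section moments.
Context {R : realType} {T : nat}.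
Implicit Types x : 'cV[R]_T.

Definition sumx x : R := \sum_(i < T) x i 0.
Definition sumsq x : R := \sum_(i < T) x i 0 ^+ 2.

Lemma l1norm_orthant x : orthant x -> l1norm x = sumx x.
Proof. by move=> x0; apply: eq_bigr => i _; rewrite ger0_norm. Qed.

Lemma l2norm_sqr x : l2norm x ^+ 2 = sumsq x.
Proof. by rewrite sqr_sqrtr// sumr_ge0// => i _; rewrite sqr_ge0. Qed.

Lemma sumx_ge0 x : orthant x -> 0 <= sumx x.
Proof. by move=> x0; rewrite sumr_ge0. Qed.

Lemma sumsq_ge0 x : 0 <= sumsq x.
Proof. by rewrite sumr_ge0// => i _; rewrite sqr_ge0. Qed.

Lemma sumsq_le x : orthant x -> sumsq x <= sumx x ^+ 2.
Proof.
move=> x0; rewrite expr2 {1}/sumx mulr_suml; apply: ler_sum => i _.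
rewrite expr2 ler_wpM2l// /sumx (bigD1 i)//= lerDl.
by rewrite sumr_ge0.
Qed.

(** The difference of the two sides is the sum of squared deviations of the coordinates from their
    mean. *)
Lemma sumsq_ge x : (0 < T)%N -> sumx x ^+ 2 / T%:R <= sumsq x.
Proof.
move=> T0; have T1 : 0 < T%:R :> R by rewrite ltr0n.
have : 0 <= \sum_(i < T) (x i 0 - sumx x / T%:R) ^+ 2.
  by rewrite sumr_ge0// => i _; rewrite sqr_ge0.
under eq_bigr do rewrite sqrrB.
rewrite big_split sumrB/= -/(sumsq x) sumr_const card_ord sumrMnl -mulr_suml.
rewrite -/(sumx x) -[_ ^+ 2 *+ T]mulr_natl.
rewrite (_ : _ + _ = sumsq x - sumx x ^+ 2 / T%:R) ?subr_ge0//.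
by field; rewrite gt_eqF.
Qed.

(** Constant vectors attain the bound of [sumsq_ge]; the multiples of unit vectors below attain that
    of [sumsq_le]. *)
Lemma const_mx_moments (c : R) :
  sumx (const_mx c) = T%:R * c /\ sumsq (const_mx c) = T%:R * c ^+ 2.
Proof.
split; rewrite /sumx /sumsq; under eq_bigr do rewrite mxE;
by rewrite sumr_const card_ord -[LHS]mulr_natl.
Qed.

Lemma delta_mx_moments (i : 'I_T) (c : R) :
  sumx (c *: delta_mx i 0) = c /\ sumsq (c *: delta_mx i 0) = c ^+ 2.
Proof.
split; rewrite /sumx /sumsq (bigD1 i)//= big1 ?addr0 => [|j /negPf ji];
  by rewrite !mxE ?eqxx ?ji ?mulr1 ?mulr0 ?expr0n.
Qed.

End moments.

(** * Moments attainable by finitely supported measures *)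

Section moment_cone.
Context {R : realType} {T : nat}.

Let quadD (a b c d a' b' c' d' : R) :
  ((a, b, c, d) : R^o * R^o * R^o * R^o) + (a', b', c', d') =
  (a + a', b + b', c + c', d + d').
Proof. by []. Qed.

Let quadZ (k a b c d : R) :
  k *: ((a, b, c, d) : R^o * R^o * R^o * R^o) = (k * a, k * b, k * c, k * d).
Proof. by []. Qed.

Variable h : 'cV[R]_T -> R.

(** [R^o] is [R] as a module over itself, so that the quadruples form an [lmodType], as
    [cone_extension] requires. *)
Definition moments (x : 'cV[R]_T) : R^o * R^o * R^o * R^o :=
  (1, sumx x, sumx x ^+ 2, sumsq x).

(** The weights need not sum to 1: the first component of [v] records the total mass, which makes
    the relation a convex cone. *)
Definition moment_cone (v : R^o * R^o * R^o * R^o) (t : R) : Prop :=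
  exists l : seq (R * 'cV[R]_T),
  [/\ forall z, z \in l -> 0 <= z.1 /\ orthant z.2,
      v = \sum_(z <- l) z.1 *: moments z.2 &
      t = \sum_(z <- l) z.1 * (h z.2 <= 0)%R%:R].

Lemma sum_momentsE (l : seq (R * 'cV[R]_T)) :
  \sum_(z <- l) z.1 *: moments z.2 =
  (\sum_(z <- l) z.1, \sum_(z <- l) z.1 * sumx z.2,
   \sum_(z <- l) z.1 * sumx z.2 ^+ 2, \sum_(z <- l) z.1 * sumsq z.2).
Proof.
elim: l => [|z l IH]; first by rewrite !big_nil.
by rewrite !big_cons IH quadZ quadD mulr1.
Qed.

Lemma moment_coneD v w t u :
  moment_cone v t -> moment_cone w u -> moment_cone (v + w) (t + u).
Proof.
move=> [l1 [l10 -> ->]] [l2 [l20 -> ->]]; exists (l1 ++ l2); split.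
- by move=> z; rewrite mem_cat => /orP[/l10|/l20].
- by rewrite big_cat.
- by rewrite big_cat.
Qed.

Lemma moment_coneZ (k : R) v t :
  0 <= k -> moment_cone v t -> moment_cone (k *: v) (k * t).
Proof.
move=> k0 [l [l0 -> ->]]; exists [seq (k * z.1, z.2) | z <- l]; split.
- by move=> z /mapP[z' /l0[z0 o] ->]; split => //=; rewrite mulr_ge0.
- by rewrite big_map scaler_sumr; apply: eq_bigr => z _; rewrite scalerA.
- by rewrite big_map mulr_sumr; apply: eq_bigr => z _; rewrite mulrA.
Qed.

Lemma moment_cone_atom x : orthant x -> moment_cone (moments x) (h x <= 0)%R%:R.
Proof.
move=> ox; exists [:: (1, x)]; rewrite !big_seq1 scale1r mul1r; split => // z.
by rewrite inE => /eqP ->.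
Qed.

Lemma moment_cone_le a b c d t : moment_cone (a, b, c, d) t -> t <= a.
Proof.
move=> [l [l0 /(congr1 (fun v => v.1.1.1)) /= -> ->]].
rewrite sum_momentsE /=.
rewrite big_seq [leRHS]big_seq; apply: ler_sum => z /l0[z0 _].
by rewrite -[leRHS]mulr1 ler_wpM2l// lern1 leq_b1.
Qed.

Hypothesis T2 : (2 <= T)%N.

(* Three atoms: the origin, a vertex and the barycenter of the simplex
   [sumx x = c / b]; the last two have extreme values of [sumsq]. *)
Lemma moment_cone_mem (a b c d : R) : 0 < a -> 0 < b -> b ^+ 2 <= a * c ->
  c / T%:R <= d <= c -> exists t, moment_cone (a, b, c, d) t.
Proof.
move=> a0 b0 bac /andP[cd dc].
have T1 : 2 <= T%:R :> R by rewrite ler_nat.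
have c0 : 0 < c by rewrite -(pmulr_rgt0 _ a0); apply: lt_le_trans bac; rewrite exprn_gt0.
have i0 : 'I_T by exact: (Ordinal (ltnW T2)).
pose be := c / b.
have be0 : 0 < be by rewrite divr_gt0.
pose x1 : 'cV[R]_T := be *: delta_mx i0 0.
pose x2 : 'cV[R]_T := const_mx (be / T%:R).
pose D := be ^+ 2 * (1 - T%:R^-1).
have TV : T%:R^-1 < 1 :> R by rewrite invf_lt1; lra.
have D0 : 0 < D by rewrite mulr_gt0 ?exprn_gt0//; lra.
(* [D] is the gap between [sumsq x1] and [sumsq x2]. The moments [b] and [c] force
   [w1 + w2 = b ^+ 2 / c], [d] fixes the split, and the origin takes the remaining mass. *)
pose w1 := (d - c / T%:R) / D; pose w2 := (c - d) / D; pose w0 := a - b ^+ 2 / c.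
have w10 : 0 <= w1 by rewrite divr_ge0 ?subr_ge0// ltW.
have w20 : 0 <= w2 by rewrite divr_ge0 ?subr_ge0// ltW.
have w00 : 0 <= w0 by rewrite subr_ge0 ler_pdivrMr.
have C0 : moment_cone (1, 0, 0, 0) (h 0 <= 0)%R%:R.
  have -> : (1, 0, 0, 0) = moments 0.
    have [e1 e2] := @const_mx_moments R T 0.
    by rewrite /moments e1 e2 !expr0n/= !mulr0 expr0n.
  by apply: moment_cone_atom => i; rewrite mxE.
have C1 : moment_cone (1, be, be ^+ 2, be ^+ 2) (h x1 <= 0)%R%:R.
  have [e1 e2] := @delta_mx_moments R T i0 be.
  have -> : (1, be, be ^+ 2, be ^+ 2) = moments x1 by rewrite /moments e1 e2.
  by apply: moment_cone_atom => i; rewrite !mxE mulr_ge0 ?ler0n// ltW.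
have C2 : moment_cone (1, be, be ^+ 2, be ^+ 2 / T%:R) (h x2 <= 0)%R%:R.
  have [e1 e2] := @const_mx_moments R T (be / T%:R).
  have -> : (1, be, be ^+ 2, be ^+ 2 / T%:R) = moments x2.
    have e : T%:R * (be / T%:R) = be by field; lra.
    by rewrite /moments e1 e2 e; congr (_, _); field; lra.
  by apply: moment_cone_atom => i; rewrite !mxE divr_ge0// ltW.
have := moment_coneD _ _ _ _ (moment_coneZ _ _ _ w00 C0)
  (moment_coneD _ _ _ _ (moment_coneZ _ _ _ w10 C1) (moment_coneZ _ _ _ w20 C2)).
set v := (_ + _); set t := (_ + _) => Cv; exists t.
suff <- : v = (a, b, c, d) by [].
have w12 : w1 + w2 = b ^+ 2 / c.
  by rewrite /w1 /w2 /D /be; field; lra.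
have w12' : (w1 + w2 / T%:R) * be ^+ 2 = d.
  by rewrite /w1 /w2 /D /be; field; lra.
rewrite /v !quadZ !quadD; congr (_, _, _, _).
- by rewrite /w0 !mulr1 w12 subrK.
- by rewrite mulr0 add0r -mulrDl w12 /be; field; lra.
- by rewrite mulr0 add0r -mulrDl w12 /be; field; lra.
- by rewrite mulr0 add0r -[RHS]w12' mulrDl mulrA [_ * be ^+ 2 / _]mulrAC.
Qed.

(** Scaling by a large [k] turns the strict inequalities into slacks that absorb unit perturbations:
    the moment vector is interior in its last three directions. *)
Lemma moment_cone_interior (m1 m2 mq : R) :
  0 < m1 -> m1 ^+ 2 < m2 -> m2 / T%:R < mq < m2 -> exists k : R, forall d1 d2 dq : R,
  `|d1| <= 1 -> `|d2| <= 1 -> `|dq| <= 1 ->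
  exists t, moment_cone (k, k * m1 + d1, k * m2 + d2, k * mq + dq) t.
Proof.
move=> m1_gt0 m12 /andP[m2q mq2].
have T1 : 2 <= T%:R :> R by rewrite ler_nat.
(* Each threshold secures one condition of [moment_cone_mem]. For [k2], what is needed is [k ^+ 2 *
   (m2 - m1 ^+ 2) >= 2 * k * m1 + k + 1], and the right side is at most [k * (2 * m1 + 2)] once
   [k >= 1]. *)
pose k1 := 2 / m1; pose k2 := (2 * m1 + 2) / (m2 - m1 ^+ 2).
pose k3 := 2 / (mq - m2 / T%:R); pose k4 := 2 / (m2 - mq).
have k10 : 0 <= k1 by rewrite divr_ge0; lra.
have k20 : 0 <= k2 by rewrite divr_ge0; lra.
have k30 : 0 <= k3 by rewrite divr_ge0; lra.
have k40 : 0 <= k4 by rewrite divr_ge0; lra.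
pose k := 1 + k1 + k2 + k3 + k4; exists k.
have bnd u v : 0 < v -> u / v <= k -> u <= k * v by move=> v0; rewrite ler_pdivrMr.
have b1 : 2 <= k * m1 by apply: bnd => //; rewrite -/k1 /k; lra.
have b2 : 2 * m1 + 2 <= k * (m2 - m1 ^+ 2) by apply: bnd; rewrite -/k2 /k; lra.
have b3 : 2 <= k * (mq - m2 / T%:R) by apply: bnd; rewrite -/k3 /k; lra.
have b4 : 2 <= k * (m2 - mq) by apply: bnd; rewrite -/k4 /k; lra.
have k_ge1 : 1 <= k by rewrite /k; lra.
move: k {bnd} b1 b2 b3 b4 k_ge1 => k b1 b2 b3 b4 k_ge1 d1 d2 dq.
rewrite !ler_norml => /andP[? ?] /andP[? ?] /andP[? ?].
have k0 : 0 <= k by lra.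
apply: moment_cone_mem; [lra|lra| |].
- have b2' : k * (2 * m1 + 2) <= k * (k * (m2 - m1 ^+ 2)) by rewrite ler_wpM2l.
  have : (k * m1 + d1) ^+ 2 <= (k * m1 + 1) ^+ 2 by rewrite ler_pXn2r// ?nnegrE; lra.
  by nra.
- have : d2 / T%:R <= 1 by rewrite ler_pdivrMr; lra.
  by rewrite mulrDl; lra.
Qed.

(** The linear majorant given by [cone_extension] is exact at the prescribed moments; evaluated at a
    single atom, it becomes a quadratic majorant of the indicator. *)
Lemma moment_dual (m1 m2 mq : R) :
  0 < m1 -> m1 ^+ 2 < m2 -> m2 / T%:R < mq < m2 ->
  has_sup [set t | moment_cone (1, m1, m2, mq) t] /\
  exists al be g1 g2,
  al + be * m1 + g2 * m2 + g1 * mq = sup [set t | moment_cone (1, m1, m2, mq) t] /\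
  forall x, orthant x ->
    (h x <= 0)%R%:R <= al + be * sumx x + g2 * sumx x ^+ 2 + g1 * sumsq x.
Proof.
move=> m1_gt0 m12 m2q; have /andP[m2q1 mq2] := m2q.
have Msup : has_sup [set t | moment_cone (1, m1, m2, mq) t].
  split; last by exists 1 => t; exact: moment_cone_le.
  by apply: moment_cone_mem; rewrite ?mul1r// ltW//= ?ltW.
split => //; set p := sup _.
have [k kP] := moment_cone_interior _ _ _ m1_gt0 m12 m2q.
(* These are the directions of the three nontrivial moments; indices above 2 give the zero vector,
   for which interiority still holds. *)
pose x (i : nat) : R^o * R^o * R^o * R^o :=
  (0, (i == 0)%:R, (i == 1)%:R, (i == 2)%:R).
have bN (b : bool) : `|b%:R : R| <= 1 by case: b; rewrite ?normr0 ?normr1.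
have intp i : exists k t, moment_cone (k *: (1, m1, m2, mq) + x i) t.
  exists k; rewrite quadZ quadD mulr1 addr0.
  by apply: kP; exact: bN.
have intn i : exists k t, moment_cone (k *: (1, m1, m2, mq) - x i) t.
  exists k; have -> : - x i = (0, - (i == 0)%:R, - (i == 1)%:R, - (i == 2)%:R).
    by rewrite -scaleN1r quadZ mulr0 !mulN1r.
  rewrite quadZ quadD mulr1 addr0.
  by apply: kP; rewrite normrN; exact: bN.
have [y yP] := @cone_extension R _ moment_cone _ x
  moment_coneD moment_coneZ Msup intp intn 3.
(* [y 2] is the slope in [sumsq], hence [g1], and [y 1] is [g2]. The constant absorbs the shift,
   since [moments z] is expanded around the prescribed moments. *)
exists (p - m1 * y 0 - m2 * y 1 - mq * y 2), (y 0), (y 2), (y 1); split; first by ring.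
move=> z oz.
pose c i : R := [:: sumx z - m1; sumx z ^+ 2 - m2; sumsq z - mq]`_i.
have := yP 1 c (h z <= 0)%R%:R.
rewrite !big_ord_recl !big_ord0/= /c/= => /(_ _)/le_trans; apply; last by rewrite -/p; lra.
have -> : 1 *: (1, m1, m2, mq) + ((sumx z - m1) *: x 0 +
   ((sumx z ^+ 2 - m2) *: x 1 + ((sumsq z - mq) *: x 2 + 0))) = moments z.
  rewrite addr0 !quadZ !quadD /moments.
  by congr (_, _, _, _) => /=; ring.
exact: moment_cone_atom.
Qed.

End moment_cone.

(** * Feasible points of the program as quadratic majorants *)

Section semi_infinite_constraints.
Context {R : realType} {T : nat}.
Variable h : 'cV[R]_T -> R.
Hypothesis T2 : (2 <= T)%N.

Lemma phi_valuesE x : orthant x -> h x <= 0 ->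
  phi_values h (sumx x) (sumsq x)%:E.
Proof. by move=> ox hx; exists x; [rewrite /= l1norm_orthant|rewrite l2norm_sqr]. Qed.

Lemma phi_fin s : S_set h s -> exists lo up : R,
  [/\ phi_lo h s = lo%:E, phi_up h s = up%:E,
      exists2 x, [/\ orthant x, sumx x = s & h x <= 0] &
        lo <= sumsq x <= up,
      forall b, (forall x, orthant x -> sumx x = s -> h x <= 0 -> b <= sumsq x) ->
        b <= lo &
      forall b, (forall x, orthant x -> sumx x = s -> h x <= 0 -> sumsq x <= b) ->
        up <= b].
Proof.
move=> [s0 /ereal_inf_lt[v Pv _]].
have [x [ox sx hx] vE] := Pv; rewrite l1norm_orthant// in sx.
rewrite l2norm_sqr in vE; rewrite -vE in Pv.
have lo_v : (phi_lo h s <= (sumsq x)%:E)%E by exact: ereal_inf_lbound.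
have up_v : ((sumsq x)%:E <= phi_up h s)%E by exact: ereal_sup_ubound.
have lo_ge b : (forall x, orthant x -> sumx x = s -> h x <= 0 -> b <= sumsq x) ->
    (b%:E <= phi_lo h s)%E.
  move=> bP; apply: le_ereal_inf_tmp => _ [y [oy sy hy] <-].
  by rewrite l2norm_sqr lee_fin bP// -l1norm_orthant.
have up_le b : (forall x, orthant x -> sumx x = s -> h x <= 0 -> sumsq x <= b) ->
    (phi_up h s <= b%:E)%E.
  move=> bP; apply: ge_ereal_sup => _ [y [oy sy hy] <-].
  by rewrite l2norm_sqr lee_fin bP// -l1norm_orthant.
have lo0 : (0%:E <= phi_lo h s)%E by apply: lo_ge => y *; exact: sumsq_ge0.
have upS : (phi_up h s <= (s ^+ 2)%:E)%E.
  by apply: up_le => y oy <- _; exact: sumsq_le.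
have lof : phi_lo h s \is a fin_num.
  by rewrite fin_numElt (lt_le_trans _ lo0) ?ltNyr// (le_lt_trans lo_v) ?ltry.
have upf : phi_up h s \is a fin_num.
  by rewrite fin_numElt (lt_le_trans _ up_v) ?ltNyr// (le_lt_trans upS) ?ltry.
exists (fine (phi_lo h s)), (fine (phi_up h s)); split; rewrite ?fineK//.
- by exists x => //; rewrite -!lee_fin !fineK// lo_v.
- by move=> b /lo_ge; rewrite -lee_fin fineK.
- by move=> b /up_le; rewrite -lee_fin fineK.
Qed.

Lemma sip_feasible_majorant al l1 l2 be g1 g2 :
  sip_feasible h al l1 l2 be g1 g2 -> forall x, orthant x ->
  (h x <= 0)%R%:R <= al + be * sumx x + g2 * sumx x ^+ 2 + g1 * sumsq x.
Proof.
move=> [[al0 l10 l20] [c1 d1] [c2 d2] lo up] x ox.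
have s0 := sumx_ge0 _ ox.
have T0 : 0 < T%:R :> R by rewrite ltr0n ltnW.
have ql : sumx x ^+ 2 / T%:R <= sumsq x by rewrite sumsq_ge// ltnW.
have qu := sumsq_le _ ox.
have [hx|hx] := boolP (h x <= 0).
  have Ss : S_set h (sumx x).
    split=> //; apply: le_lt_trans (ltry (sumsq x)).
    exact/ereal_inf_lbound/phi_valuesE.
  have [lo' [up' [loE upE _ lo_ge up_le]]] := phi_fin _ Ss.
  have := lo _ Ss; have := up _ Ss.
  rewrite loE upE -!EFinM -!EFinD !lee_fin => upx lox.
  have lo_x : lo' <= sumsq x.
    by rewrite -lee_fin -loE; exact/ereal_inf_lbound/phi_valuesE.
  have up_x : sumsq x <= up'.
    by rewrite -lee_fin -upE; exact/ereal_sup_ubound/phi_valuesE.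
  (* The sign of [g1] decides which extreme of [sumsq] is the worst case. *)
  have [g0|g0] := leP 0 g1.
    by apply: le_trans lox _; rewrite lerD2l ler_wpM2l.
  by apply: le_trans upx _; rewrite lerD2l ler_wnM2l// ltW.
rewrite addrC in c1; rewrite addrC in c2.
rewrite soc_constraintE// in d1;
rewrite soc_constraintE// in d2.
have q1 := quadratic_ge0 _ _ _ _ _ al0 c1 l10 d1 s0.
have q2 := quadratic_ge0 _ _ _ _ _ al0 c2 l20 d2 s0.
(* Likewise where [h x > 0]: the worst [sumsq x] is [sumx x ^+ 2 / T%:R] for [g1 >= 0] and
   [sumx x ^+ 2] otherwise. *)
have [g0|g0] := leP 0 g1.
  apply: le_trans q2 _; rewrite mulrDl addrA lerD2l mulrAC -mulrA.
  by rewrite ler_wpM2l.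
apply: le_trans q1 _; rewrite mulrDl addrA lerD2l.
by rewrite ler_wnM2l// ltW.
Qed.

(** The constraints are the majorant tested at the origin, on the axis of a unit vector, on the
    diagonal, and on the slices of [h x <= 0]. *)
Lemma majorant_sip_feasible (al be g1 g2 : R) :
  (forall x, orthant x ->
    (h x <= 0)%R%:R <= al + be * sumx x + g2 * sumx x ^+ 2 + g1 * sumsq x) ->
  exists l1 l2, sip_feasible h al l1 l2 be g1 g2.
Proof.
move=> maj.
have T0 : 0 < T%:R :> R by rewrite ltr0n ltnW.
have maj0 (x : 'cV[R]_T) : orthant x -> 0 <= al + be * sumx x + g2 * sumx x ^+ 2 + g1 * sumsq x.
  by move=> ox; have := maj _ ox; apply: le_trans; rewrite ler0n.
have al0 : 0 <= al.
  have [e1 e2] := @const_mx_moments R T 0.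
  have := maj0 (const_mx 0); rewrite e1 e2 !expr0n/= !mulr0 expr0n/= !mulr0 !addr0.
  by apply => i; rewrite mxE.
have i0 : 'I_T by exact: (Ordinal (ltnW T2)).
have [s s0|c1 [l1 l10 d1]] := @quadratic_multiplier _ al be (g2 + g1).
  have [e1 e2] := @delta_mx_moments R T i0 s.
  have := maj0 (s *: delta_mx i0 0); rewrite e1 e2 mulrDl addrA; apply => i.
  by rewrite !mxE mulr_ge0 ?ler0n.
have [s s0|c2 [l2 l20 d2]] := @quadratic_multiplier _ al be (g2 + g1 / T%:R).
  have [e1 e2] := @const_mx_moments R T (s / T%:R).
  have := maj0 (const_mx (s / T%:R)); rewrite e1 e2.
  have -> : T%:R * (s / T%:R) = s by field; lra.
  have -> : T%:R * (s / T%:R) ^+ 2 = s ^+ 2 / T%:R by field; lra.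
  rewrite mulrDl addrA [g1 / _ * _]mulrAC -[g1 * _ / _]mulrA; apply => i.
  by rewrite mxE divr_ge0// ltW.
exists l1, l2; split.
- by split.
- by rewrite addrC soc_constraintE.
- by rewrite addrC soc_constraintE.
- move=> s /phi_fin[lo [up [-> _ [x [ox sx hx] /andP[lox xup]] lo_ge _]]].
  rewrite -EFinM -EFinD lee_fin.
  (* For [g1 > 0] the majorant is solved for [sumsq y] and passed to the infimum; otherwise the
     single witness [x] suffices, as [lo <= sumsq x]. *)
  have [g0|g0] := ltP 0 g1.
    rewrite -lerBlDl [g1 * _]mulrC -ler_pdivrMr//; apply: lo_ge => y oy sy hy.
    rewrite ler_pdivrMr// [_ * g1]mulrC lerBlDl -sy; have := maj _ oy.
    by rewrite hy.
  have := maj _ ox; rewrite hx sx => /le_trans; apply.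
  by rewrite lerD2l ler_wnM2l.
- move=> s /phi_fin[lo [up [_ -> [x [ox sx hx] /andP[lox xup]] _ up_le]]].
  rewrite -EFinM -EFinD lee_fin.
  have [g0|g0] := ltP g1 0.
    rewrite -lerBlDl [g1 * _]mulrC -ler_ndivlMr//; apply: up_le => y oy sy hy.
    rewrite ler_ndivlMr// [_ * g1]mulrC lerBlDl -sy; have := maj _ oy.
    by rewrite hy.
  have := maj _ ox; rewrite hx sx => /le_trans; apply.
  by rewrite lerD2l ler_wpM2l.
Qed.

End semi_infinite_constraints.

(** * Finitely supported probability measures *)

Section probability_of_measure.
Context {d : measure_display} {X : measurableType d} {R : realType}.
Variables (m : {measure set X -> \bar R}) (m1 : m setT = 1%E).

(** Taking the mass-one proof as an argument lets this alias of [m] carry a probability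
    structure. *)
Definition probability_of_measure of m setT = 1%E : set X -> \bar R := m.

HB.instance Definition _ := Measure.copy (probability_of_measure m1) m.

HB.instance Definition _ :=
  Measure_isProbability.Build _ _ _ (probability_of_measure m1) m1.

End probability_of_measure.

Section discrete_probability.
Context {d : measure_display} {X : measurableType d} {R : realType}.
Implicit Types l : seq (R * X).

Lemma discrete_measure l : all (fun z : R * X => 0 <= z.1) l ->
  exists m : {measure set X -> \bar R},
    (forall A, m A = (\sum_(z <- l) z.1 * \1_A z.2)%:E) /\
    forall f : X -> R, measurable_fun setT f -> (forall x, 0 <= f x) ->
      (\int[m]_x (f x)%:E)%E = (\sum_(z <- l) z.1 * f z.2)%:E.
Proof.
elim: l => [_|[w x] l IH /= /andP[w0 /IH[m [mE intm]]]].
  exists mzero; split => [A|f mf f0]; rewrite big_nil//.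
  by rewrite integral_measure_zero.
exists (measure_add (mscale (NngNum w0) \d_x) m); split => [A|f mf f0].
  rewrite [LHS](measure_addE _ _ A) mE big_cons.
  by rewrite /= /mscale/= diracE indicE -EFinM -EFinD.
have /measurable_EFinP mf' := mf.
have f0' x' : setT x' -> (0 <= (f x')%:E)%E by rewrite lee_fin.
rewrite ge0_integral_measure_add// ge0_integral_mscale// integral_dirac//=.
by rewrite diracT mul1e intm// big_cons EFinD EFinM.
Qed.

Lemma discrete_probability l : all (fun z : R * X => 0 <= z.1) l ->
  \sum_(z <- l) z.1 = 1 ->
  exists P : probability X R,
    (forall A, P A = (\sum_(z <- l) z.1 * \1_A z.2)%:E) /\
    forall f : X -> R, measurable_fun setT f ->
      expectation P f = (\sum_(z <- l) z.1 * f z.2)%:E.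
Proof.
move=> l0 l1; have [m [mE intm]] := discrete_measure _ l0.
have m1 : m setT = 1%E.
  by rewrite mE -l1; congr _%:E; apply: eq_bigr => z _; rewrite indicT mulr1.
exists (probability_of_measure m m1); split => [A|f mf]; first exact: mE.
rewrite unlock integralE (funerpos f) (funerneg f) !intm; last first.
- exact: funrpos_ge0.
- exact: measurable_funrpos.
- exact: funrneg_ge0.
- exact: measurable_funrneg.
rewrite -EFinB -sumrB; congr _%:E; apply: eq_bigr => z _; rewrite -mulrBr.
by rewrite -[in RHS](funrposBneg f).
Qed.

End discrete_probability.

(** * Borel measurability in the space of column vectors *)

Section borel.
Context {R : realType} {T : nat}.

Lemma continuous_borel_measurable (f : 'cV[R]_T -> R) : continuous f ->
  measurable_fun (setT : set (borel_cV R T)) f.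
Proof.
move=> /continuousP cf; apply: (measurability _ (RGenOpens.measurableE R)).
move=> _ [_ [a [b ->] <-]]; rewrite setTI; apply: sub_sigma_algebra.
exact/cf/interval_open.
Qed.

Lemma closed_borel_measurable (A : set 'cV[R]_T) : closed A ->
  measurable (A : set (borel_cV R T)).
Proof.
move=> /closed_openC oA; rewrite -[A]setCK; apply: measurableC.
exact: sub_sigma_algebra.
Qed.

Lemma closed_orthant : closed (@orthant R T).
Proof.
have -> : @orthant R T = \bigcap_(i in [set: 'I_T])
    ((fun x : 'cV[R]_T => x i 0) @^-1` [set r | 0 <= r]).
  by apply/seteqP; split => x ox i; [move=> _|]; exact: ox.
apply: closed_bigI => i _; apply: preimage_closed; last exact: closed_ge.
by move=> x _; exact: coord_continuous.
Qed.

(** Continuity on the orthant makes the sublevel set relatively closed; it is closed because the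
    orthant itself is. *)
Lemma closed_orthant_sublevel (h : 'cV[R]_T -> R) :
  {within @orthant R T, continuous h} -> closed [set x | orthant x /\ h x <= 0].
Proof.
move=> ch.
rewrite (_ : mkset _ = (h @^-1` [set r | r <= 0]) `&` @orthant R T); last first.
  by apply/seteqP; split => x [].
rewrite (closed_setIS _ closed_orthant).
by move/continuous_closedP : ch; apply; exact: closed_le.
Qed.

End borel.

(** * Means of integrable functions *)

Section has_mean.
Context {d : measure_display} {X : measurableType d} {R : realType}.
Variable P : probability X R.

(** Integrability is bundled with the value so that means combine linearly without indeterminate
    forms. *)
Definition has_mean (f : X -> R) (r : R) : Prop :=
  P.-integrable setT (EFin \o f) /\ (\int[P]_x (f x)%:E)%E = r%:E.

Lemma expectation_has_mean f r : measurable_fun setT f ->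
  expectation P f = r%:E -> has_mean f r.
Proof.
rewrite unlock => mf fr; split => //; apply/integrableP; split.
  exact/measurable_EFinP.
by rewrite [ltLHS]/= integral_fin_num_abs// fr.
Qed.

Lemma has_mean_cst r : has_mean (cst r) r.
Proof.
split; first exact: finite_measure_integrable_cst.
rewrite -[LHS]/(\int[P]_x (cst r%:E) x)%E integral_cst//.
by rewrite -[X in (_ * X)%E]/(P setT) (probability_setT P) mule1.
Qed.

Lemma has_meanD f g r s : has_mean f r -> has_mean g s ->
  has_mean (f \+ g) (r + s).
Proof.
move=> [fi fr] [gi gs]; split; first exact: integrableD fi gi.
by rewrite (integralD_EFin _ fi gi)// fr gs.
Qed.

Lemma has_meanZ k f r : has_mean f r -> has_mean (fun x => k * f x) (k * r).
Proof.
move=> [fi fr]; split; first exact: (integrableZl _ k fi).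
by under eq_integral do rewrite EFinM; rewrite (integralZl _ fi)// fr.
Qed.

Lemma has_mean_sum (I : Type) (l : seq I) (f : I -> X -> R) (r : I -> R) :
  (forall i, has_mean (f i) (r i)) ->
  has_mean (fun x => \sum_(i <- l) f i x) (\sum_(i <- l) r i).
Proof.
move=> fr; elim: l => [|i l IH].
  rewrite big_nil (_ : (fun _ => _) = cst 0); first exact: has_mean_cst.
  by apply/funext => x; rewrite big_nil.
rewrite big_cons (_ : (fun _ => _) = f i \+ (fun x => \sum_(j <- l) f j x)).
  exact: has_meanD.
by apply/funext => x; rewrite big_cons.
Qed.

(** The complement of [D] is null, so both integrals may be restricted to [D], where the comparison
    is pointwise. *)
Lemma has_mean_ge_measure f r (A D : set X) : has_mean f r ->
  measurable A -> measurable D -> P D = 1%E ->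
  (forall x, D x -> \1_A x <= f x) -> (P A <= r%:E)%E.
Proof.
move=> [fi <-] mA mD PD fA.
have mDC : measurable (~` D) by exact: measurableC.
have PDC : P (~` D) = 0%E by rewrite probability_setC// PD subee.
have A1 := integrable_indic P mA.
rewrite -[A]setIT -integral_indic//.
rewrite (negligible_integral mDC _ A1)// (negligible_integral mDC _ fi)//.
apply: le_integral; rewrite ?setTD ?setCK//.
- exact: integrableS A1.
- exact: integrableS fi.
- by move=> x /set_mem Dx; rewrite lee_fin fA.
Qed.

End has_mean.

(** * Averages over the symmetric group *)

Section permutation_average.
Context {R : comRingType} {T : nat}.

(** By transitivity the sum over permutations does not depend on [i]; summing over all indices and
    exchanging the sums gives the identity. *)
Lemma sum_perm1 (f : 'I_T -> R) i :
  T%:R * (\sum_(s : 'S_T) f (s i)) = T`!%:R * \sum_(j < T) f j.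
Proof.
have sumE j : \sum_(s : 'S_T) f (s j) = \sum_(s : 'S_T) f (s i).
  rewrite (reindex_inj (mulgI (tperm i j)))/=.
  by apply: eq_bigr => s _; rewrite permM tpermR.
transitivity (\sum_(j < T) \sum_(s : 'S_T) f (s j)).
  by rewrite [RHS](eq_bigr _ (fun j _ => sumE j)) sumr_const card_ord mulr_natl.
rewrite exchange_big/= mulr_natl -card_Sn -sumr_const; apply: eq_bigr => s _.
by rewrite [RHS](reindex_inj (@perm_inj _ s)).
Qed.

(** The same argument with double transitivity, over the [T * T.-1] ordered pairs of distinct
    indices. *)
Lemma sum_perm2 (f : 'I_T -> 'I_T -> R) i j : i != j ->
  (T * T.-1)%:R * (\sum_(s : 'S_T) f (s i) (s j)) =
  T`!%:R * \sum_(k < T) \sum_(l < T | l != k) f k l.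
Proof.
move=> ij.
have sumE k l : l != k ->
    \sum_(s : 'S_T) f (s k) (s l) = \sum_(s : 'S_T) f (s i) (s j).
  (* The first transposition sends [i] to [k]; the second sends the image of [j] to [l] and fixes
     [k]. *)
  move=> kl; pose t := (tperm i k * tperm (tperm i k j) l)%g.
  have ti : t i = k.
    rewrite permM tpermL tpermD//; apply: contra_neq ij => jk.
    by apply: (@perm_inj _ (tperm i k)); rewrite jk tpermL.
  have tj : t j = l by rewrite permM tpermL.
  rewrite [RHS](reindex_inj (mulgI t))/=.
  by apply: eq_bigr => s _; rewrite !(permM t s) ti tj.
transitivity (\sum_(k < T) \sum_(l < T | l != k) \sum_(s : 'S_T) f (s k) (s l)).
  have rowE k : \sum_(l < T | l != k) \sum_(s : 'S_T) f (s k) (s l) =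
      (\sum_(s : 'S_T) f (s i) (s j)) *+ T.-1.
    by rewrite (eq_bigr _ (sumE k)) sumr_const cardC1 card_ord.
  rewrite [RHS](eq_bigr _ (fun k _ => rowE k)) sumr_const card_ord -mulrnA mulnC.
  by rewrite mulr_natl.
under eq_bigr do rewrite exchange_big/=.
rewrite exchange_big/= mulr_natl -card_Sn -sumr_const; apply: eq_bigr => s _.
rewrite [RHS](reindex_inj (@perm_inj _ s))/=; apply: eq_bigr => k _.
rewrite [RHS](reindex_inj (@perm_inj _ s))/=; apply: eq_bigl => l.
by rewrite (inj_eq perm_inj).
Qed.

End permutation_average.

(** * The ambiguity set and its scalar moments *)

Section strong_duality.
Context {R : realType} {T : nat}.
Variables (mu sigma rho : R).
Implicit Types x : 'cV[R]_T.

(** [secm] is the off-diagonal second moment; [m1], [m2] and [mq] are the means of [sumx], its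
    square and [sumsq] under any member of the ambiguity set. *)
Let secm : R := rho * sigma ^+ 2 + mu ^+ 2.
Let m1 : R := T%:R * mu.
Let m2 : R := T%:R * (T%:R * mu ^+ 2 + sigma ^+ 2 + (T%:R - 1) * rho * sigma ^+ 2).
Let mq : R := T%:R * (mu ^+ 2 + sigma ^+ 2).

Lemma second_moment_entry (i j : 'I_T) :
  (cov_mx T sigma rho + mean_vec T mu *m (mean_vec T mu)^T) i j =
  (1 - rho) * sigma ^+ 2 * (i == j)%:R + (rho * sigma ^+ 2 + mu ^+ 2).
Proof.
rewrite !mxE !big_ord1 !mxE !mulr1 addrA expr2; congr (_ + _ + _).
Qed.

Lemma sumx_sqr x : sumx x ^+ 2 = \sum_(i < T) \sum_(j < T) (x *m x^T) i j.
Proof.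
rewrite expr2 {1}/sumx mulr_suml; apply: eq_bigr => i _.
by rewrite mulr_sumr; apply: eq_bigr => j _; rewrite !mxE big_ord1 !mxE.
Qed.

Lemma sumsqE x : sumsq x = \sum_(i < T) (x *m x^T) i i.
Proof. by apply: eq_bigr => i _; rewrite !mxE big_ord1 !mxE expr2. Qed.

Lemma mulmx_tr_continuous (i j : 'I_T) :
  continuous (fun x : 'cV[R]_T => (x *m x^T) i j).
Proof.
have -> : (fun x : 'cV[R]_T => (x *m x^T) i j) =
    (fun x => x i 0) \* (fun x => x j 0).
  by apply/funext => x; rewrite !mxE big_ord1 !mxE.
by move=> x; apply: continuousM; exact: coord_continuous.
Qed.

(** Weak duality: the prescribed moments give the majorant the program's objective as its mean. *)
Lemma ambiguity_measure_le (P : probability (borel_cV R T) R)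
    (A : set (borel_cV R T)) (al be g1 g2 : R) :
  ambiguity_set mu sigma rho P -> measurable A ->
  (forall x, orthant x ->
    \1_A x <= al + be * sumx x + g2 * sumx x ^+ 2 + g1 * sumsq x) ->
  (P A <= (sip_objective T mu sigma rho al be g1 g2)%:E)%E.
Proof.
move=> [PO mean1 mean2] mA maj.
have h1 i : has_mean P (fun x : 'cV[R]_T => x i 0) mu.
  apply: expectation_has_mean.
    by apply: continuous_borel_measurable => x; exact: coord_continuous.
  by rewrite mean1 !mxE mulr1.
have h2 i j : has_mean P (fun x : 'cV[R]_T => (x *m x^T) i j)
    ((1 - rho) * sigma ^+ 2 * (i == j)%:R + secm).
  apply: expectation_has_mean.
    by apply: continuous_borel_measurable; exact: mulmx_tr_continuous.
  by rewrite mean2 second_moment_entry.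
have hs : has_mean P (sumx : borel_cV R T -> R) m1.
  have := has_mean_sum _ _ (index_enum 'I_T) _ _ h1.
  by rewrite sumr_const card_ord -mulr_natl.
have hq : has_mean P (sumsq : borel_cV R T -> R) mq.
  have := has_mean_sum _ _ (index_enum 'I_T) _ _ (fun i => h2 i i).
  rewrite (eq_bigr (fun=> mu ^+ 2 + sigma ^+ 2)); last first.
    by move=> i _; rewrite eqxx mulr1 /secm; ring.
  rewrite sumr_const card_ord -mulr_natl.
  by under eq_fun do rewrite -sumsqE.
have hs2 : has_mean P (fun x : borel_cV R T => sumx x ^+ 2) m2.
  have := has_mean_sum _ _ (index_enum 'I_T) _ _
    (fun i => has_mean_sum _ _ (index_enum 'I_T) _ _ (h2 i)).
  rewrite (eq_bigr (fun=> (1 - rho) * sigma ^+ 2 + T%:R * secm)); last first.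
    move=> i _; rewrite big_split/= -mulr_sumr sumr_const card_ord -[_ *+ T]mulr_natl.
    by rewrite (bigD1 i)//= eqxx big1 ?addr0 ?mulr1// => j /negPf; rewrite eq_sym => ->.
  rewrite sumr_const card_ord -[_ *+ T]mulr_natl.
  have -> : T%:R * ((1 - rho) * sigma ^+ 2 + T%:R * secm) = m2.
    by rewrite /m2 /secm; ring.
  by under eq_fun do rewrite -sumx_sqr.
have hf : has_mean P (fun x : borel_cV R T =>
    al + be * sumx x + g2 * sumx x ^+ 2 + g1 * sumsq x)
    (sip_objective T mu sigma rho al be g1 g2).
  have -> : sip_objective T mu sigma rho al be g1 g2 =
      al + be * m1 + g2 * m2 + g1 * mq.
    by rewrite /sip_objective /m1 /m2 /mq; ring.
  apply: has_meanD; last exact: has_meanZ.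
  apply: has_meanD; last exact: has_meanZ.
  by apply: has_meanD; [exact: has_mean_cst|exact: has_meanZ].
apply: (has_mean_ge_measure P _ _ A (@orthant R T) hf) => //.
exact: closed_borel_measurable (@closed_orthant R T).
Qed.

Variable h : 'cV[R]_T -> R.
Hypotheses (T2 : (2 <= T)%N) (hsym : perm_symmetric h).

(* Averaging over the coordinate permutations turns the three scalar moments
   into the full first and second moments required by the ambiguity set. *)
Lemma moment_cone_symmetrize t :
  measurable ([set x | orthant x /\ h x <= 0] : set (borel_cV R T)) ->
  moment_cone h (1, m1, m2, mq) t ->
  exists2 P : probability (borel_cV R T) R, ambiguity_set mu sigma rho P &
    P [set x | orthant x /\ h x <= 0] = t%:E.
Proof.
move=> mA [l [l0 lm lt]].
move: lm; rewrite sum_momentsE => -[lw ls ls2 lq].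
have T1 : 2 <= T%:R :> R by rewrite ler_nat.
have F0 : (T`!%:R : R) != 0 by rewrite pnatr_eq0 -lt0n fact_gt0.
pose l' := [seq (z.1 / T`!%:R, row_perm s z.2) | z <- l, s <- index_enum 'S_T].
have sumE (f : 'cV[R]_T -> R) : \sum_(z <- l') z.1 * f z.2 =
    \sum_(z <- l) z.1 / T`!%:R * \sum_(s : 'S_T) f (row_perm s z.2).
  rewrite big_allpairs_dep/=; apply: eq_bigr => z _.
  by rewrite mulr_sumr.
have sum_inv (f : 'cV[R]_T -> R) :
    (forall z s, z \in l -> f (row_perm s z.2) = f z.2) ->
    \sum_(z <- l') z.1 * f z.2 = \sum_(z <- l) z.1 * f z.2.
  move=> fs; rewrite sumE big_seq [RHS]big_seq; apply: eq_bigr => z zl.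
  rewrite (eq_bigr (fun=> f z.2)) => [|s _]; last exact: fs.
  rewrite sumr_const card_Sn -[f _ *+ _]mulr_natl mulrA divfK//.
have perm_orthant z s : z \in l -> orthant (row_perm s z.2).
  by move=> /l0[_ o] i; rewrite mxE.
have l'0 : all (fun z : R * borel_cV R T => 0 <= z.1) l'.
  apply/allP => _ /allpairsP[[z s] [/l0[z0 _] _ ->]] /=.
  by rewrite divr_ge0.
have l'1 : \sum_(z <- l') z.1 = 1.
  have := sum_inv (fun=> 1) (fun _ _ _ => erefl).
  by under eq_bigr do rewrite mulr1; move=> ->; under eq_bigr do rewrite mulr1.
have [P [PE EP]] := discrete_probability _ l'0 l'1.
exists P.
  split.
  - rewrite PE (sum_inv (\1_(@orthant R T))) => [|z s zl]; last first.
      by rewrite !indicE !mem_set//; [case: (l0 _ zl)|exact: perm_orthant].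
    rewrite lw; congr _%:E; apply: eq_big_seq => z zl.
    by rewrite indicE mem_set ?mulr1//; case: (l0 _ zl).
  - move=> i; rewrite EP; last first.
      by apply: continuous_borel_measurable => x; exact: coord_continuous.
    rewrite (sumE (fun x => x i 0)) !mxE mulr1; congr _%:E.
    have TN0 : T%:R != 0 :> R by lra.
    apply: (mulfI TN0); rewrite -/m1 ls mulr_sumr; apply: eq_bigr => z _.
    under eq_bigr do rewrite mxE.
    by rewrite mulrCA (sum_perm1 (fun i => z.2 i 0)) mulrA divfK.
  - move=> i j; rewrite EP; last first.
      by apply: continuous_borel_measurable; exact: mulmx_tr_continuous.
    rewrite second_moment_entry (sumE (fun x => (x *m x^T) i j)); congr _%:E.
    have entryE (z : 'cV[R]_T) s : (row_perm s z *m (row_perm s z)^T) i j = z (s i) 0 * z (s j) 0.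
      by rewrite !mxE big_ord1 !mxE.
    under eq_bigr do under eq_bigr do rewrite entryE.
    have [<-|ij] := eqVneq i j.
      have TN0 : T%:R != 0 :> R by lra.
      apply: (mulfI TN0); transitivity mq; last by rewrite mulr1 /mq; ring.
      rewrite lq mulr_sumr; apply: eq_bigr => z _.
      rewrite mulrCA (sum_perm1 (fun i => z.2 i 0 * z.2 i 0)) mulrA divfK//.
    (* Off the diagonal, the products of distinct coordinates add up to [sumx x ^+ 2 - sumsq x], of
       mean [m2 - mq], shared equally among the ordered pairs. *)
    have TN0 : (T * T.-1)%:R != 0 :> R.
      by rewrite pnatr_eq0 muln_eq0; case: (T) T2 => [|[]].
    apply: (mulfI TN0); transitivity (m2 - mq); last first.
      by rewrite mulr0 add0r natrM -subn1 natrB ?(ltnW T2)// /m2 /mq; ring.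
    rewrite ls2 lq -sumrB mulr_sumr; apply: eq_bigr => z _.
    rewrite mulrCA (sum_perm2 (fun i j => z.2 i 0 * z.2 j 0))// mulrA divfK//.
    rewrite -mulrBr; congr (_ * _); apply/eqP; rewrite eq_sym subr_eq; apply/eqP.
    rewrite sumx_sqr -big_split/=; apply: eq_bigr => k _.
    rewrite (bigD1 k)//= addrC !mxE big_ord1 !mxE expr2; congr (_ + _).
    by apply: eq_bigr => k' _; rewrite !mxE big_ord1 !mxE.
rewrite PE; congr _%:E.
rewrite (sum_inv (\1_[set x | orthant x /\ h x <= 0])) => [|z s zl].
  rewrite lt; apply: eq_big_seq => z zl; congr (_ * _).
  rewrite indicE; congr ((nat_of_bool _)%:R); apply/idP/idP => [/set_mem[]//|hz].
  by apply/mem_set; split => //; case: (l0 _ zl).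
rewrite !indicE; congr ((nat_of_bool _)%:R); have [_ oz] := l0 _ zl.
apply/idP/idP => /set_mem[_ hz]; apply/mem_set; split => //.
- by rewrite -(hsym s).
- exact: perm_orthant.
- by rewrite hsym.
Qed.

End strong_duality.

Theorem theorem6p1 (R : realType) (T : nat) (mu sigma rho : R)
    (hT : (2 <= T)%N) (hmu : 0 < mu) (hsigma : 0 < sigma)
    (hrho_lo : - (1 / (T%:R - 1)) < rho) (hrho_up : rho < 1)
    (hmoment : 0 < mu ^+ 2 + rho * sigma ^+ 2)
    (h : 'cV[R]_T -> R)
    (hcont : {within @orthant R T, continuous h})
    (hsym : perm_symmetric h) :
  worst_case_prob mu sigma rho h = sip_value mu sigma rho h.
Proof.
pose A : set (borel_cV R T) := [set x : 'cV[R]_T | orthant x /\ h x <= 0].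
have mA : measurable A by exact: closed_borel_measurable (closed_orthant_sublevel _ hcont).
have T1 : 2 <= T%:R :> R by rewrite ler_nat.
apply/eqP; rewrite eq_le; apply/andP; split.
  apply: ge_ereal_sup => _ [P PP <-]; apply: le_ereal_inf_tmp.
  move=> _ [al [l1 [l2 [be [g1 [g2 [/(sip_feasible_majorant _ hT) maj ->]]]]]]].
  apply: (ambiguity_measure_le _ _ _ _ A _ _ _ _ PP mA) => x ox.
  apply: le_trans (maj _ ox); rewrite indicE ler_nat.
  by have [/set_mem[_ ->]|] := boolP (x \in A).
pose m1 : R := T%:R * mu.
pose m2 : R := T%:R * (T%:R * mu ^+ 2 + sigma ^+ 2 + (T%:R - 1) * rho * sigma ^+ 2).
pose mq : R := T%:R * (mu ^+ 2 + sigma ^+ 2).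
have s2 : 0 < sigma ^+ 2 by rewrite exprn_gt0.
have rho1 : 0 < 1 + (T%:R - 1) * rho.
  have T10 : 0 < T%:R - 1 :> R by lra.
  have : (T%:R - 1) * - (1 / (T%:R - 1)) < (T%:R - 1) * rho by rewrite ltr_pM2l.
  by rewrite mulrN mulrA mulr1 divff ?gt_eqF//; lra.
(* The gaps [m2 - m1 ^+ 2], [mq - m2 / T%:R] and [m2 - mq] are positive multiples of
   [1 + (T%:R - 1) * rho], [1 - rho] and [mu ^+ 2 + rho * sigma ^+ 2], so the parameter bounds are
   exactly interiority. *)
have [|||Msup [al [be [g1 [g2 [pE maj]]]]]] := moment_dual h hT m1 m2 mq.
- by rewrite mulr_gt0//; lra.
- rewrite -subr_gt0 (_ : _ - _ = T%:R * sigma ^+ 2 * (1 + (T%:R - 1) * rho)).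
    by rewrite !mulr_gt0//; lra.
  by rewrite /m1 /m2; ring.
- rewrite -subr_gt0 -[mq < _]subr_gt0.
  rewrite (_ : mq - _ = (T%:R - 1) * sigma ^+ 2 * (1 - rho)); last first.
    by rewrite /mq /m2; field; lra.
  rewrite (_ : m2 - _ = T%:R * (T%:R - 1) * (mu ^+ 2 + rho * sigma ^+ 2)); last first.
    by rewrite /mq /m2; ring.
  by rewrite !mulr_gt0//; lra.
have [l1 [l2 feas]] := majorant_sip_feasible h hT _ _ _ _ maj.
apply: (@le_trans _ _ (sip_objective T mu sigma rho al be g1 g2)%:E).
  apply: ereal_inf_lbound; exists al, l1, l2, be, g1, g2; by split.
rewrite (_ : sip_objective _ _ _ _ _ _ _ _ =
    sup [set t | moment_cone h (1, m1, m2, mq) t]); last first.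
  by rewrite -pE /sip_objective /m1 /m2 /mq; ring.
have le_worst t : moment_cone h (1, m1, m2, mq) t ->
    (t%:E <= worst_case_prob mu sigma rho h)%E.
  move=> /(moment_cone_symmetrize _ _ _ _ hT hsym _ mA)[P PP <-].
  by apply: ereal_sup_ubound; exists P.
(* If the worst case is not finite, an attainable mass rules out [-oo], and [+oo] is an upper bound
   trivially. *)
have [w|] := boolP (worst_case_prob mu sigma rho h \is a fin_num).
  rewrite -(fineK w) lee_fin; apply: ge_sup Msup.1 _ => t /le_worst.
  by rewrite -(fineK w) lee_fin.
have [t0 /le_worst] := Msup.1.
by case: (worst_case_prob mu sigma rho h) => // _ _; rewrite leey.
Qed.
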